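(* Let $V$ be an infinite-dimensional complex Hilbert space. Then in the bosonic Fock space $S[V]$, the domain $\mathcal{D}[N^{\frac{1}{2}}]$ is properly contained in the maximal common domain $\bigcap_{v \in V} \big(\mathcal{D}[c(v)] \cap \mathcal{D}[a(v)]\big)$ of all creators and annihilators.
   Context: Let $V$ be a complex Hilbert space with inner product $\langle \cdot \vert \cdot \rangle$ (antilinear in the first slot). Let $SV = \bigoplus_{n \geq 0} S^n V$ be the (algebraic) symmetric algebra, with inner product making the $S^n V$ mutually perpendicular and $\langle x_1 \cdots x_n \vert y_1 \cdots y_n \rangle = \sum_{p} \prod_{j=1}^n \langle x_j \vert y_{p(j)} \rangle$ (sum over permutations $p$ of $\{1,\dots,n\}$). The bosonic Fock space $S[V] = \bigoplus_{n \geq 0} S^n[V]$ is the Hilbert space completion, $S^n[V]$ being the closure of $S^n V$. Let $SV'$ be the space of all antilinear functionals $SV \to \mathbf{C}$; $SV$ embeds in $SV'$ via $\phi \mapsto \langle \cdot \vert \phi \rangle$, and $S[V]$ is identified with the subspace of bounded antilinear functionals. For $v \in V$, the creator $c(v)$ on $SV$ is multiplication by $v$, and the annihilator $a(v)$ on $SV$ is the derivation with $a(v)\mathbf{1} = 0$ and $a(v)(v_1 \cdots v_n) = \sum_{j=1}^n \langle v \vert v_j \rangle v_1 \cdots \widehat{v_j} \cdots v_n$. They extend to $SV'$ by $[c(v)\Phi](\psi) = \Phi[a(v)\psi]$ and $[a(v)\Phi](\psi) = \Phi[c(v)\psi]$ for $\psi \in SV$. The operators in Fock space have domains $\mathcal{D}[c(v)]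 = \{\Phi \in S[V] : c(v)\Phi \in S[V]\}$ and $\mathcal{D}[a(v)] = \{\Phi \in S[V] : a(v)\Phi \in S[V]\}$ (these coincide). The number operator $N$ acts as $nI$ on $S^n[V]$; writing $\Phi = \sum_{n \geq 0} \Phi_n$ with $\Phi_n \in S^n[V]$, $\mathcal{D}[N^{\frac{1}{2}}] = \{\Phi \in S[V] : \sum_{n \geq 0} n \Vert \Phi_n \Vert^2 < \infty\}$. *)

(* Defs.v *)
(* MathComp + MathComp-Analysis (classical, reals) + real_closed complex. *)
From mathcomp Require Import all_boot all_order all_algebra all_fingroup.
From mathcomp Require Import all_classical all_reals.
From mathcomp Require Export complex.
Set Implicit Arguments. Unset Strict Implicit. Unset Printing Implicit Defensive.
Import Order.TTheory GRing.Theory Num.Theory.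
Local Open Scope ring_scope.
Local Open Scope complex_scope.

(* ---------- Scalars: C := R[i] for a real field R ---------- *)
(* modulus of a complex number, as a real number *)
Definition cabs (R : realType) (z : R[i]) : R := Num.sqrt (complex.Re z ^+ 2 + complex.Im z ^+ 2).

(* ---------- Complex Hilbert space V with inner product ip ----------
   ip is antilinear in the first slot, linear in the second. *)
Definition vnorm (R : realType) (V : lmodType R[i]) (ip : V -> V -> R[i]) (v : V) : R :=
  Num.sqrt (complex.Re (ip v v)).

Definition is_complex_hilbert (R : realType) (V : lmodType R[i]) (ip : V -> V -> R[i]) : Prop :=
  [/\ (forall (u v w : V) (a : R[i]), ip u (a *: v + w) = a * ip u v + ip u w),
      (forall u v : V, ip u v = (ip v u)^*),
      (forall v : V, 0 <= ip v v),
      (forall v : V, ip v v = 0 -> v = 0) &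
      (* completeness w.r.t. the norm induced by ip *)
      (forall u : nat -> V,
         (forall e : R, 0 < e -> exists N : nat, forall m n : nat,
             (N <= m)%N -> (N <= n)%N -> vnorm ip (u m - u n) < e) ->
         exists l : V, forall e : R, 0 < e -> exists N : nat, forall n : nat,
             (N <= n)%N -> vnorm ip (u n - l) < e)].

(* V is infinite-dimensional: no finite family spans V *)
Definition infinite_dimensional (R : realType) (V : lmodType R[i]) : Prop :=
  forall s : seq V, exists v : V,
    forall cs : seq R[i], v <> \sum_(i < size s) cs`_i *: s`_i.

(* ---------- The algebraic symmetric algebra SV ----------
   An element of SV is represented by a finite formal linear combination
   sum_k c_k (w_k) of monomials, a monomial w = [:: v_1; ...; v_n]
   standing for the symmetric product v_1 ... v_n (n = 0 gives the unit 1).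
   The Fock inner product below is multilinear and symmetric, and its null
   space on formal combinations is exactly the kernel of the map onto SV, so
   everything defined below only depends on the element of SV represented. *)
Definition word (R : realType) (V : lmodType R[i]) := seq V.
Definition formal (R : realType) (V : lmodType R[i]) := seq (R[i] * seq V).

(* <x_1 ... x_n | y_1 ... y_m> = [n = m] sum_p prod_j <x_j | y_p(j)> *)
Definition wip (R : realType) (V : lmodType R[i]) (ip : V -> V -> R[i])
    (x y : seq V) : R[i] :=
  if size x == size y then
    \sum_(p : 'S_(size x)) \prod_(j < size x) ip (nth 0 x j) (nth 0 y (p j))
  else 0.

(* inner product on SV, antilinear in the first slot *)
Definition fip (R : realType) (V : lmodType R[i]) (ip : V -> V -> R[i])
    (psi chi : seq (R[i] * seq V)) : R[i] :=
  \sum_(a <- psi) \sum_(b <- chi) (a.1)^* * b.1 * wip ip a.2 b.2.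

Definition fnorm (R : realType) (V : lmodType R[i]) (ip : V -> V -> R[i])
    (psi : seq (R[i] * seq V)) : R :=
  Num.sqrt (complex.Re (fip ip psi psi)).

(* psi lies in S^n V *)
Definition homog (R : realType) (V : lmodType R[i]) (n : nat)
    (psi : seq (R[i] * seq V)) : bool :=
  all (fun a => size a.2 == n) psi.

(* ---------- Antilinear functionals on SV ----------
   An antilinear functional Phi : SV -> C is determined by its values on
   monomials; Phi (sum_k c_k w_k) = sum_k conj(c_k) Phi(w_k). *)
Definition fapply (R : realType) (V : lmodType R[i]) (Phi : seq V -> R[i])
    (psi : seq (R[i] * seq V)) : R[i] :=
  \sum_(a <- psi) (a.1)^* * Phi a.2.

(* Phi is bounded on SV; the bosonic Fock space S[V] is identified with the
   bounded antilinear functionals on SV (a bounded functional automatically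
   vanishes on the null space, so is well defined on SV). *)
Definition in_Fock (R : realType) (V : lmodType R[i]) (ip : V -> V -> R[i])
    (Phi : seq V -> R[i]) : Prop :=
  exists M : R, forall psi : seq (R[i] * seq V),
    cabs (fapply Phi psi) <= M * fnorm ip psi.

(* annihilator a(v) on a monomial:
   a(v)(v_1...v_n) = sum_j <v|v_j> v_1 ..^v_j.. v_n *)
Definition ann_word (R : realType) (V : lmodType R[i]) (ip : V -> V -> R[i])
    (v : V) (w : seq V) : seq (R[i] * seq V) :=
  [seq (ip v (nth 0 w j), take j w ++ drop j.+1 w) | j <- iota 0 (size w)].

(* extended creator on SV': [c(v)Phi](psi) = Phi[a(v) psi] *)
Definition cre_ext (R : realType) (V : lmodType R[i]) (ip : V -> V -> R[i])
    (v : V) (Phi : seq V -> R[i]) : seq V -> R[i] :=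
  fun w => fapply Phi (ann_word ip v w).

(* extended annihilator on SV': [a(v)Phi](psi) = Phi[c(v) psi] *)
Definition ann_ext (R : realType) (V : lmodType R[i])
    (v : V) (Phi : seq V -> R[i]) : seq V -> R[i] :=
  fun w => Phi (v :: w).

(* domains in Fock space *)
Definition dom_cre (R : realType) (V : lmodType R[i]) (ip : V -> V -> R[i])
    (v : V) (Phi : seq V -> R[i]) : Prop :=
  in_Fock ip Phi /\ in_Fock ip (cre_ext ip v Phi).

Definition dom_ann (R : realType) (V : lmodType R[i]) (ip : V -> V -> R[i])
    (v : V) (Phi : seq V -> R[i]) : Prop :=
  in_Fock ip Phi /\ in_Fock ip (ann_ext v Phi).

(* norm of the component Phi_n in S^n[V]: the norm of Phi restricted to S^n V *)
Definition comp_norm (R : realType) (V : lmodType R[i]) (ip : V -> V -> R[i])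
    (Phi : seq V -> R[i]) (n : nat) : R :=
  sup [set cabs (fapply Phi psi) / fnorm ip psi |
         psi in [set psi : seq (R[i] * seq V) | homog n psi /\ fnorm ip psi <> 0]]%classic.

(* D[N^{1/2}] = { Phi in S[V] : sum_n n ||Phi_n||^2 < oo } *)
Definition dom_sqrtN (R : realType) (V : lmodType R[i]) (ip : V -> V -> R[i])
    (Phi : seq V -> R[i]) : Prop :=
  in_Fock ip Phi /\
  exists M : R, forall K : nat, \sum_(n < K) n%:R * comp_norm ip Phi n ^+ 2 <= M.

(* maximal common domain of all creators and annihilators *)
Definition common_dom (R : realType) (V : lmodType R[i]) (ip : V -> V -> R[i])
    (Phi : seq V -> R[i]) : Prop :=
  forall v : V, dom_cre ip v Phi /\ dom_ann ip v Phi.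

(* Main.v *)
(* On S^n V the relation [a(v), c(v)] = |v|^2 gives, by induction on n, the bounds
   |c(v) psi| <= sqrt(n+1) |v| |psi| and |a(v) psi| <= sqrt n |v| |psi|; by duality
   the sum of the n |Phi_n|^2 controls c(v) Phi and a(v) Phi, whence the inclusion.
   It is proper: for an orthonormal sequence (e_n), the vector
   sum_(n >= 1) e_n^n / (n sqrt n!) has components of norm 1/n, so that
   sum n |Phi_n|^2 is the harmonic series, whereas the degree n - 1 component of
   a(v) Phi has norm |<v|e_n>| / sqrt n, which is square-summable by Bessel. *)
Require Import Defs.
From mathcomp Require Import all_boot all_order all_algebra all_fingroup.
From mathcomp Require Import all_classical all_reals.
From mathcomp Require Import complex.
From mathcomp Require Import ring lra.
Local Open Scope classical_set_scope.
Import Order.TTheory GRing.Theory Num.Theory.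
Local Open Scope ring_scope.
Local Notation "x %:C" := (real_complex _ x) : ring_scope.
Set Implicit Arguments.
Unset Strict Implicit.
Unset Printing Implicit Defensive.

(** * Elementary inequalities for real numbers and finite sums *)

Section RealInequalities.
Variable R : realType.

(** The quadratic is minimal at t = 1/A. Its shape is that of a Hermitian form at z = - t b, with B
    = |b|^2. *)
Lemma discriminant_le (A B C : R) : 0 <= A ->
  (forall t, 0 <= t ^+ 2 * (B * A) - 2 * t * B + C) -> 0 <= B -> B <= A * C.
Proof.
rewrite le_eqVlt => /predU1P[<-|A0] quad B0.
  rewrite mul0r leNgt; apply/negP => Bpos.
  (* For A = 0 the quadratic is affine in t; this t gives it the value -1. *)
  have := quad ((C + 1) / (2 * B)).
  suff -> : ((C + 1) / (2 * B)) ^+ 2 * (B * 0) -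
            2 * ((C + 1) / (2 * B)) * B + C = -1 by lra.
  by field; rewrite gt_eqF.
have := quad A^-1.
have -> : A^-1 ^+ 2 * (B * A) - 2 * A^-1 * B + C = (A * C - B) / A.
  by field; rewrite gt_eqF.
by rewrite pmulr_lge0 ?invr_gt0 // subr_ge0.
Qed.

Lemma sum_CS (n : nat) (b x : nat -> R) :
  (\sum_(i < n) b i * x i) ^+ 2 <=
  (\sum_(i < n) b i ^+ 2) * (\sum_(i < n) x i ^+ 2).
Proof.
elim: n => [|n IH]; first by rewrite !big_ord0 mul0r expr0n.
rewrite !big_ord_recr /=.
set S := \sum_(i < n) _ in IH *; set B := \sum_(i < n) _ in IH *.
set X := \sum_(i < n) _ in IH *.
have B0 : 0 <= B by apply: sumr_ge0 => i _; exact: sqr_ge0.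
have X0 : 0 <= X by apply: sumr_ge0 => i _; exact: sqr_ge0.
(* Compare squares: the difference is a square plus 4 (B X - S^2) (b_n x_n)^2, nonnegative by
   induction. *)
have cross : 2 * S * (b n * x n) <= B * x n ^+ 2 + b n ^+ 2 * X.
  apply: le_trans (ler_norm _) _.
  rewrite -[leRHS]ger0_norm; last first.
    by apply: addr_ge0; apply: mulr_ge0; rewrite ?sqr_ge0.
  rewrite -ler_sqr ?nnegrE ?normr_ge0 // !real_normK ?num_real //.
  have := ler_wpM2r (sqr_ge0 (b n * x n)) IH.
  have := sqr_ge0 (B * x n ^+ 2 - b n ^+ 2 * X).
  move=> h1 h2; rewrite -subr_ge0.
  have -> : (B * x n ^+ 2 + b n ^+ 2 * X) ^+ 2 - (2 * S * (b n * x n)) ^+ 2 =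
     (B * x n ^+ 2 - b n ^+ 2 * X) ^+ 2 +
     4 * (B * X * (b n * x n) ^+ 2 - S ^+ 2 * (b n * x n) ^+ 2) by ring.
  by lra.
have -> : (S + b n * x n) ^+ 2 = S ^+ 2 + 2 * S * (b n * x n) + b n ^+ 2 * x n ^+ 2.
  by ring.
have -> : (B + b n ^+ 2) * (X + x n ^+ 2) =
    B * X + (B * x n ^+ 2 + b n ^+ 2 * X) + b n ^+ 2 * x n ^+ 2 by ring.
by lra.
Qed.

Lemma sum_inv_sq_le (K : nat) : \sum_(n < K) (n%:R^-1 : R) ^+ 2 <= 2.
Proof.
(* The sharper bound makes the induction close, since 1/k - 1/(k+1) exceeds 1/(k+1)^2; the term n =
   0 is zero. *)
suff : \sum_(n < K.+2) (n%:R^-1 : R) ^+ 2 <= 2 - K.+1%:R^-1.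
  rewrite 2!big_ord_recr /= => h; have a0 : 0 <= K.+1%:R^-1 :> R by rewrite invr_ge0.
  move: h (sqr_ge0 (K%:R^-1 : R)) (sqr_ge0 (K.+1%:R^-1 : R)) a0.
  move: (K.+1%:R^-1 : R) (\sum_(i < K) _) ((K%:R^-1 : R) ^+ 2) ((K.+1%:R^-1 : R) ^+ 2) => *.
  by lra.
elim: K => [|K IH]; first by rewrite 2!big_ord_recr big_ord0 /= invr0 invr1; lra.
rewrite big_ord_recr /=; apply: le_trans (lerD IH (lexx _)) _.
have K1 : 0 < K.+1%:R :> R by [].
have -> : K.+2%:R = K.+1%:R + 1 :> R by rewrite -natr1.
move: K1; move: (K.+1%:R : R) => k k0.
have k10 : 0 < k + 1 by apply: addr_gt0.
rewrite -subr_ge0.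
have -> : 2 - (k + 1)^-1 - (2 - k^-1 + (k + 1)^-1 ^+ 2) = (k * (k + 1) ^+ 2)^-1.
  by field; rewrite (gt_eqF k0) (gt_eqF k10).
by rewrite invr_ge0 mulr_ge0 ?sqr_ge0 ?ltW.
Qed.

(* Oresme: each dyadic block of the harmonic series contributes at least 1/2. *)
Lemma harmonic_dyadic_ge (k : nat) : k%:R / 2 <= \sum_(n < 2 ^ k) (n.+1%:R^-1 : R).
Proof.
elim: k => [|k IH]; first by rewrite expn0 big_ord_recr big_ord0 /= mul0r add0r invr1.
rewrite expnS mul2n -addnn big_split_ord /= -natr1 mulrDl; apply: lerD => //.
apply: le_trans (_ : \sum_(i < 2 ^ k) (2 * (2 ^ k)%:R)^-1 <= _).
  have N0 : (2 ^ k)%:R != 0 :> R by rewrite pnatr_eq0 expn_eq0.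
  by rewrite sumr_const card_ord -mulr_natr le_eqVlt; apply/orP; left; apply/eqP; field.
apply: ler_sum => i _; rewrite lef_pV2 ?posrE ?mulr_gt0 ?ltr0n ?expn_gt0 //.
by rewrite -natrM ler_nat mul2n -addnn -addnS leq_add2l.
Qed.

End RealInequalities.

(** * The modulus of complex numbers *)

Section ComplexModulus.
Variable R : realType.
Implicit Types z w : R[i].

Lemma cabsE z : (cabs z)%:C = `|z|.
Proof. by rewrite normc_def. Qed.

Lemma cabs_ge0 z : 0 <= cabs z.
Proof. exact: sqrtr_ge0. Qed.

Lemma cabs0 : cabs (0 : R[i]) = 0.
Proof. by apply: complexI; rewrite cabsE normr0. Qed.

Lemma cabsM z w : cabs (z * w) = cabs z * cabs w.
Proof. by apply: complexI; rewrite rmorphM /= !cabsE normrM. Qed.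

Lemma cabs_real (x : R) : 0 <= x -> cabs x%:C = x.
Proof. by move=> x0; apply: complexI; rewrite cabsE ger0_norm // ler0c. Qed.

Lemma conj_realc (x : R) : (x%:C)^* = x%:C.
Proof. exact: conjc_real. Qed.

Lemma cabs_sq z : (cabs z ^+ 2)%:C = z * z^*.
Proof. by rewrite rmorphXn /= cabsE normCK. Qed.

Lemma cabs_sum (I : Type) (r : seq I) (P : pred I) (F : I -> R[i]) :
  cabs (\sum_(i <- r | P i) F i) <= \sum_(i <- r | P i) cabs (F i).
Proof.
rewrite -lecR cabsE rmorph_sum /=; apply: le_trans (ler_norm_sum _ _ _) _.
by apply: ler_sum => i _; rewrite cabsE.
Qed.

Lemma ReE z : 0 <= z -> (complex.Re z)%:C = z.
Proof. by move=> z0; apply: RRe_real; exact: ger0_real. Qed.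

(** Here a = <x|x>, b = <x|y>, c = <y|y>, and the hypothesis is positivity on every z x + y. Taking
    z = - t b with t real leaves a real quadratic. *)
Lemma sesquilinear_CS (a b c : R[i]) : 0 <= a -> 0 <= c ->
  (forall z, 0 <= z * z^* * a + z^* * b + z * b^* + c) ->
  cabs b ^+ 2 <= complex.Re a * complex.Re c.
Proof.
move=> a0 c0 pos; apply: discriminant_le; last exact: sqr_ge0.
  by rewrite -ler0c ReE.
move=> t; have := pos (- (t%:C * b)); rewrite -ler0c; congr (_ <= _).
rewrite rmorphN rmorphM /= conj_realc.
move: (cabs_sq b); move: (cabs b ^+ 2) => B HB.
rewrite expr2 rmorphD rmorphB /= !rmorphM /= HB !ReE // rmorph_nat.
by ring.
Qed.

End ComplexModulus.

(** * Orthonormal families in V: Bessel, Parseval and Gram-Schmidt *)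

Section Orthonormal.
Variables (R : realType) (V : lmodType R[i]) (ip : V -> V -> R[i]).
Hypothesis ipH : is_complex_hilbert ip.
Implicit Types (u v w : V) (E : seq V).

Lemma ipC u v : ip u v = (ip v u)^*.
Proof. by case: ipH. Qed.

Lemma ip_ge0 v : 0 <= ip v v.
Proof. by case: ipH. Qed.

Lemma ip_eq0 v : ip v v = 0 -> v = 0.
Proof. by case: ipH => _ _ _ + _; apply. Qed.

Lemma ipDr u v w : ip u (v + w) = ip u v + ip u w.
Proof. by case: ipH => lin _ _ _ _; have := lin u v w 1; rewrite scale1r mul1r. Qed.

Lemma ip0r u : ip u 0 = 0.
Proof. by apply: (@addrI _ (ip u 0)); rewrite -ipDr !addr0. Qed.

Lemma ipZr u a v : ip u (a *: v) = a * ip u v.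
Proof. by case: ipH => lin _ _ _ _; rewrite -[a *: v]addr0 lin ip0r addr0. Qed.

Lemma ipBr u v w : ip u (v - w) = ip u v - ip u w.
Proof. by rewrite ipDr -scaleN1r ipZr mulN1r. Qed.

Lemma ip_sumr u (I : Type) (r : seq I) (P : pred I) (F : I -> V) :
  ip u (\sum_(i <- r | P i) F i) = \sum_(i <- r | P i) ip u (F i).
Proof. exact: (big_morph (ip u) (ipDr u) (ip0r u)). Qed.

Lemma ipZl a u v : ip (a *: u) v = a^* * ip u v.
Proof. by rewrite ipC ipZr rmorphM /= -ipC. Qed.

Lemma vnorm_ge0 v : 0 <= vnorm ip v.
Proof. exact: sqrtr_ge0. Qed.

Lemma vnorm_sq v : (vnorm ip v ^+ 2)%:C = ip v v.
Proof. by rewrite sqr_sqrtr ?ReE ?ip_ge0 // -ler0c ReE ip_ge0. Qed.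

Definition orthonormal E :=
  forall i j, (i < size E)%N -> (j < size E)%N -> ip E`_i E`_j = (i == j)%:R.

(** For orthonormal [E], the component of [v] orthogonal to the span of [E]; its vanishing says that
    [v] lies in that span. *)
Definition residual E v := v - \sum_(i < size E) ip E`_i v *: E`_i.

Lemma residual_perp E v i : orthonormal E -> (i < size E)%N ->
  ip E`_i (residual E v) = 0.
Proof.
move=> oE iE; rewrite ipBr ip_sumr (bigD1 (Ordinal iE)) //= ipZr oE // eqxx.
rewrite mulr1 big1 ?addr0 ?subrr // => j neq_ji.
rewrite ipZr oE // (_ : (i == j) = false) ?mulr0 //.
by apply: contraNF neq_ji => /eqP eq_ij; apply/eqP/val_inj.
Qed.

Lemma residual_ip E v : orthonormal E ->
  ip (residual E v) (residual E v) =
  ip v v - \sum_(i < size E) ip v E`_i * ip E`_i v.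
Proof.
move=> oE; have perp w : ip (residual E w) (\sum_(i < size E) ip E`_i v *: E`_i) = 0.
  rewrite ip_sumr big1 // => i _.
  by rewrite ipZr [ip (residual E w) _]ipC residual_perp // rmorph0 mulr0.
rewrite [X in ip _ X]/residual ipBr perp subr0 ipC ipBr ip_sumr rmorphB /= -ipC.
rewrite rmorph_sum; congr (_ - _); apply: eq_bigr => i _.
by rewrite ipZr rmorphM /= -!ipC mulrC.
Qed.

Lemma bessel E v : orthonormal E ->
  \sum_(i < size E) cabs (ip v E`_i) ^+ 2 <= vnorm ip v ^+ 2.
Proof.
move=> oE; rewrite -lecR vnorm_sq -subr_ge0 rmorph_sum /=.
under eq_bigr do rewrite cabs_sq -ipC.
by rewrite -residual_ip // ip_ge0.
Qed.

Lemma parseval E u v : residual E v = 0 ->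
  ip u v = \sum_(i < size E) (ip E`_i u)^* * ip E`_i v.
Proof.
move/eqP; rewrite subr_eq0 => /eqP {1}->; rewrite ip_sumr.
by apply: eq_bigr => i _; rewrite ipZr mulrC -ipC.
Qed.

Lemma orthonormal_rcons E u : orthonormal E -> ip u u = 1 ->
  (forall i, (i < size E)%N -> ip E`_i u = 0) -> orthonormal (rcons E u).
Proof.
move=> oE u1 perp i j; rewrite size_rcons !ltnS !nth_rcons => iE jE.
case: (ltngtP i (size E)) iE => // [iE _|-> _];
  case: (ltngtP j (size E)) jE => //.
- by move=> jE _; exact: oE.
- by move=> -> _; rewrite perp // ltn_eqF.
- by move=> jE _; rewrite ipC perp // rmorph0.
Qed.

Lemma unit_vector_along r : r <> 0 -> exists2 a : R[i],
  a != 0 & ip (a *: r) (a *: r) = 1.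
Proof.
move=> r0; have nr0 : vnorm ip r != 0.
  apply/eqP => nr; apply: r0; apply: ip_eq0.
  by rewrite -vnorm_sq nr expr0n.
exists (vnorm ip r)^-1%:C; first by rewrite fmorph_eq0 invr_eq0.
rewrite ipZl ipZr -vnorm_sq conj_realc -!rmorphM /= -(rmorph1 (real_complex R)).
by congr _%:C; field.
Qed.

(** A vector with nonzero residual contributes its normalized residual u as a new member; the
    residual along the larger family loses its u-component. *)
Lemma gram_schmidt (s : seq V) :
  exists2 E, orthonormal E & forall v, v \in s -> residual E v = 0.
Proof.
elim: s => [|v s [E oE Es]]; first by exists [::].
have [Ev|/eqP] := eqVneq (residual E v) 0.
  by exists E => // w; rewrite inE => /predU1P[->|/Es].
move=> /unit_vector_along[a a0 norm1]; set u := a *: _ in norm1.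
have perp i : (i < size E)%N -> ip E`_i u = 0.
  by move=> iE; rewrite ipZr residual_perp // mulr0.
have resE w : residual (rcons E u) w = residual E w - ip u w *: u.
  rewrite /residual size_rcons big_ord_recr /= nth_rcons ltnn eqxx opprD addrA.
  congr (_ - _ - _); apply: eq_bigr => i _.
  by rewrite nth_rcons ltn_ord.
exists (rcons E u); first exact: orthonormal_rcons.
move=> w; rewrite inE resE => /predU1P[->|ws].
  (* As u = a r is a unit vector, with r the residual of [v], and u is orthogonal to v - r, the
     u-component of [v] is exactly r. *)
  have : ip u v = a^-1.
    have : ip u (residual E v) = a^-1.
      by apply: (mulfI a0); rewrite -ipZr norm1 mulfV.
    rewrite ipBr ip_sumr big1 ?subr0 // => i _.
    by rewrite ipZr [ip u _]ipC perp // rmorph0 mulr0.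
  by move=> ->; rewrite scalerA mulVf // scale1r subrr.
rewrite (Es _ ws) (parseval u (Es _ ws)) big1 ?scale0r ?subr0 // => i _.
by rewrite perp // rmorph0 mul0r.
Qed.

Lemma orthonormal_sequence : infinite_dimensional V ->
  exists e : nat -> V, forall n, orthonormal (mkseq e n).
Proof.
move=> infV.
(* Orthonormality is kept as a premise inside the existential, so that choice gives an extension
   function on all lists. *)
have step E : exists u, orthonormal E -> orthonormal (rcons E u).
  case: (pselect (orthonormal E)) => [oE|]; last by exists 0.
  have [v vE] := infV E; have : residual E v <> 0.
    move/eqP; rewrite subr_eq0 => /eqP vE'.
    (* A zero residual would exhibit [v] as a combination of [E]. *)
    apply: (vE [seq ip x v | x <- E]); rewrite {1}vE'.
    by apply: eq_bigr => i _; rewrite (nth_map 0).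
  case/unit_vector_along => a _ norm1; exists (a *: residual E v) => _.
  apply: orthonormal_rcons => // i iE.
  by rewrite ipZr residual_perp // mulr0.
have [next nextP] := choice step.
pose L := fix L n := if n is n'.+1 then rcons (L n') (next (L n')) else [::].
have LE n : mkseq (next \o L) n = L n.
  by elim: n => //= n IH; rewrite mkseqS IH.
exists (next \o L) => n; rewrite LE; elim: n => [|n IH] //=.
exact: nextP.
Qed.

End Orthonormal.

(** * Expansion of a permanent along its first row *)

Section Permanent.
Variable K : comPzRingType.

Lemma permanent_expand n (F : 'I_n.+1 -> 'I_n.+1 -> K) :
  \sum_(p : 'S_n.+1) \prod_k F k (p k) =
  \sum_j F ord0 j * \sum_(s : 'S_n) \prod_k F (lift ord0 k) (lift j (s k)).
Proof.
(* A permutation amounts to the image j of 0 and a permutation of the rest; injectivity suffices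
   because (n+1)! = (n+1) n!. *)
have lift_bij : bijective (fun js : 'I_n.+1 * 'S_n => lift_perm ord0 js.1 js.2).
  apply: inj_card_bij; last first.
    by rewrite card_prod card_ord !card_Sn factS.
  move=> [j s] [j' s'] /= eq_lift.
  have eq_j : j = j' by rewrite -(lift_perm_id ord0 j s) eq_lift lift_perm_id.
  rewrite -{}eq_j in eq_lift *; congr (_, _); apply/permP => k.
  by apply: (@lift_inj _ j); rewrite -!(lift_perm_lift ord0) eq_lift.
rewrite (reindex _ (onW_bij _ lift_bij)) /=.
rewrite (eq_bigr (fun js : 'I_n.+1 * 'S_n =>
    F ord0 js.1 * \prod_k F (lift ord0 k) (lift js.1 (js.2 k)))).
  rewrite -(pair_bigA _ (fun j (s : 'S_n) =>
    F ord0 j * \prod_k F (lift ord0 k) (lift j (s k)))) /=.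
  by apply: eq_bigr => j _; rewrite mulr_sumr.
case=> j s _ /=; rewrite big_ord_recl lift_perm_id; congr (_ * _).
by apply: eq_bigr => k _; rewrite lift_perm_lift.
Qed.

End Permanent.

(** * The inner product of monomials as a permanent *)

Section WordProduct.
Variables (R : realType) (V : lmodType R[i]) (ip : V -> V -> R[i]).
Hypothesis ipH : is_complex_hilbert ip.
Implicit Types (u v : V) (x y : seq V).

Lemma wipE n x y : size x = n -> size y = n ->
  wip ip x y = \sum_(p : 'S_n) \prod_(j < n) ip x`_j y`_(p j).
Proof. by move=> <- sy; rewrite /wip sy eqxx. Qed.

Lemma wip_size x y : size x != size y -> wip ip x y = 0.
Proof. by rewrite /wip => /negPf ->. Qed.

Lemma wipC x y : wip ip x y = (wip ip y x)^*.
Proof.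
have [sxy|neq] := eqVneq (size x) (size y); last first.
  by rewrite !wip_size ?rmorph0 // eq_sym.
rewrite (wipE sxy) // (wipE _ sxy) // rmorph_sum /=.
rewrite (reindex_inj invg_inj) /=; apply: eq_bigr => p _.
rewrite rmorph_prod (reindex_inj (@perm_inj _ p)) /=.
by apply: eq_bigr => j _; rewrite permK -ipC.
Qed.

(** The body matches the words in [ann_word], so that those can be refolded. *)
Definition delete (T : Type) (j : nat) (y : seq T) := take j y ++ drop j.+1 y.

Lemma size_delete (T : Type) j (y : seq T) : (j < size y)%N ->
  size (delete j y) = (size y).-1.
Proof.
move=> jy; rewrite size_cat size_takel ?(ltnW jy) // size_drop.
by rewrite subnS -subn1 addnBA ?subn_gt0 // subnKC ?subn1 // ltnW.
Qed.

Lemma nth_delete j k y : (j < size y)%N -> (delete j y)`_k = y`_(bump j k).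
Proof.
move=> jy; rewrite nth_cat size_takel ?(ltnW jy) // /bump [(j <= k)%N]leqNgt.
case: ltnP => [kj|jk] /=; first by rewrite nth_take.
by rewrite nth_drop addSn subnKC.
Qed.

Lemma delete_nseq (T : Type) j n (u : T) : (j < n)%N ->
  delete j (nseq n u) = nseq n.-1 u.
Proof.
move=> jn; rewrite /delete take_nseq ?(ltnW jn) // drop_nseq -nseqD.
by congr nseq; rewrite subnS -!subn1 addnBA ?subn_gt0 // subnKC ?(ltnW jn).
Qed.

(** The first-row expansion of the permanent; it is the adjointness of c(v) and a(v) on
    monomials. *)
Lemma wip_cons v x y :
  wip ip (v :: x) y = \sum_(j < size y) ip v y`_j * wip ip x (delete j y).
Proof.
have [sxy|neq] := eqVneq (size x).+1 (size y); last first.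
  rewrite wip_size // big1 // => j _; rewrite wip_size ?mulr0 // size_delete //.
  by apply: contra neq => /eqP ->; rewrite prednK // (leq_ltn_trans _ (ltn_ord j)).
rewrite (@wipE (size x).+1) //.
rewrite (permanent_expand (fun k j => ip (v :: x)`_k y`_j)) -sxy.
apply: eq_bigr => j _; congr (_ * _).
have jy : (j < size y)%N by rewrite -sxy ltn_ord.
rewrite (@wipE (size x)) ?size_delete // -?sxy //.
apply: eq_bigr => s _; apply: eq_bigr => k _.
by rewrite nth_delete.
Qed.

Lemma wip_nseqr x e n : size x = n ->
  wip ip x (nseq n e) = n`!%:R * \prod_(u <- x) ip u e.
Proof.
move=> sx; rewrite (wipE sx) ?size_nseq //.
transitivity (\sum_(p : 'S_n) \prod_(u <- x) ip u e); last first.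
  by rewrite sumr_const card_Sn mulr_natl.
apply: eq_bigr => p _; rewrite (big_nth 0) big_mkord sx; apply: eq_bigr => j _.
by rewrite nth_nseq ltn_ord.
Qed.

Definition coordinate (E : seq V) n (f : {ffun 'I_n -> 'I_(size E)}) x :=
  \sum_(q : 'S_n) \prod_(j < n) ip E`_(f j) x`_(q j).

(* Expanding each factor by Parseval exhibits n! times the permanent as a Gram kernel. *)
Lemma wip_gram E n x y : (forall v, v \in y -> residual ip E v = 0) ->
  size x = n -> size y = n ->
  n`!%:R * wip ip x y =
  \sum_(f : {ffun 'I_n -> 'I_(size E)}) (coordinate f x)^* * coordinate f y.
Proof.
move=> Ey sx sy.
(* The factor n! becomes a free permutation q of the letters of x, absorbed by reindexing p and the
   product. *)
transitivity (\sum_(q : 'S_n) \sum_(p : 'S_n) \prod_(j < n) ip x`_(q j) y`_(p j)).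
  rewrite mulr_natl -card_Sn -sumr_const; apply: eq_bigr => q _.
  rewrite (wipE sx sy) (reindex_inj (mulgI q^-1%g)) /=; apply: eq_bigr => p _.
  rewrite (reindex_inj (@perm_inj _ q)) /=; apply: eq_bigr => j _.
  by rewrite permM permK.
under eq_bigr => q _ do under eq_bigr => p _ do (
  under eq_bigr => j _ do rewrite (parseval ipH _ (Ey _ (mem_nth 0 _))) ?sy //;
  rewrite bigA_distr_bigA /=).
under [RHS]eq_bigr => f _ do (rewrite /coordinate rmorph_sum mulr_suml;
  under eq_bigr => q _ do (rewrite mulr_sumr;
  under eq_bigr => p _ do rewrite rmorph_prod -big_split /=)).
rewrite [RHS]exchange_big /=; apply: eq_bigr => q _.
by rewrite exchange_big.
Qed.

End WordProduct.

(** * Positivity, Cauchy-Schwarz and the grading on formal combinations *)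

Section FockInnerProduct.
Variables (R : realType) (V : lmodType R[i]) (ip : V -> V -> R[i]).
Hypothesis ipH : is_complex_hilbert ip.
Implicit Types (v : V) (w : seq V) (psi chi : seq (R[i] * seq V)) (Phi : seq V -> R[i]).

Lemma fapply_nil Phi : fapply Phi [::] = 0.
Proof. by rewrite /fapply big_nil. Qed.

Lemma fapply_cons Phi a psi : fapply Phi (a :: psi) = a.1^* * Phi a.2 + fapply Phi psi.
Proof. by rewrite /fapply big_cons. Qed.

Lemma fapply_cat Phi psi chi : fapply Phi (psi ++ chi) = fapply Phi psi + fapply Phi chi.
Proof. by rewrite /fapply big_cat. Qed.

Lemma eq_fapply Phi Psi psi : {in [seq a.2 | a <- psi], Phi =1 Psi} ->
  fapply Phi psi = fapply Psi psi.
Proof.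
move=> eqPhi; apply: eq_big_seq => a a_psi.
by rewrite eqPhi // (map_f snd).
Qed.

Definition formal_scale (z : R[i]) psi := [seq (z * a.1, a.2) | a <- psi].

Lemma fapply_scale Phi z psi : fapply Phi (formal_scale z psi) = z^* * fapply Phi psi.
Proof.
rewrite /fapply big_map mulr_sumr; apply: eq_bigr => a _.
by rewrite rmorphM /= mulrA.
Qed.

(** The functional <.|chi>, that is, the embedding of SV into SV'. *)
Definition ket chi w : R[i] := \sum_(b <- chi) b.1 * wip ip w b.2.

Lemma fipE psi chi : fip ip psi chi = fapply (ket chi) psi.
Proof.
apply: eq_bigr => a _; rewrite mulr_sumr; apply: eq_bigr => b _.
by rewrite mulrA.
Qed.

Lemma fipC psi chi : fip ip psi chi = (fip ip chi psi)^*.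
Proof.
rewrite /fip rmorph_sum exchange_big /=; apply: eq_bigr => b _.
rewrite rmorph_sum; apply: eq_bigr => a _.
by rewrite !rmorphM /= conjCK (wipC ipH a.2) [_ * b.1]mulrC.
Qed.

Lemma fip_catl psi1 psi2 chi :
  fip ip (psi1 ++ psi2) chi = fip ip psi1 chi + fip ip psi2 chi.
Proof. by rewrite !fipE fapply_cat. Qed.

Lemma fip_scalel z psi chi : fip ip (formal_scale z psi) chi = z^* * fip ip psi chi.
Proof. by rewrite !fipE fapply_scale. Qed.

Lemma fip_catr psi1 psi2 chi :
  fip ip chi (psi1 ++ psi2) = fip ip chi psi1 + fip ip chi psi2.
Proof. by rewrite fipC fip_catl rmorphD /= -!fipC. Qed.

Lemma fip_scaler z psi chi : fip ip chi (formal_scale z psi) = z * fip ip chi psi.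
Proof. by rewrite fipC fip_scalel rmorphM /= conjCK -fipC. Qed.

Definition degree_part n psi := [seq a <- psi | size a.2 == n].

Lemma homog_degree_part n psi : homog n (degree_part n psi).
Proof. exact: filter_all. Qed.

Lemma fapply_degree_part Phi psi N : all (fun a => (size a.2 < N)%N) psi ->
  fapply Phi psi = \sum_(n < N) fapply Phi (degree_part n psi).
Proof.
elim: psi => [|a psi IH] /=; first by rewrite fapply_nil big1 // => n _; exact: fapply_nil.
case/andP => aN /IH {}IH; rewrite fapply_cons IH (bigD1 (Ordinal aN)) //=.
rewrite [RHS](bigD1 (Ordinal aN)) //= eqxx fapply_cons addrA; congr (_ + _).
apply: eq_bigr => n neq; case: eqP => // size_a.
by case/eqP: neq; apply: val_inj.
Qed.

Lemma degree_bound psi : exists N, all (fun a => (size a.2 < N)%N) psi.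
Proof.
elim: psi => [|a psi [N bound]]; first by exists 0%N.
exists (maxn (size a.2).+1 N); rewrite /= leq_maxl /=.
by apply: sub_all bound => b bN; rewrite leq_max bN orbT.
Qed.

Lemma fip_degree_part psi N : all (fun a => (size a.2 < N)%N) psi ->
  fip ip psi psi = \sum_(n < N) fip ip (degree_part n psi) (degree_part n psi).
Proof.
move=> psiN; rewrite fipE (fapply_degree_part _ psiN); apply: eq_bigr => n _.
rewrite fipE; apply: eq_fapply => w /mapP[a]; rewrite mem_filter => /andP[/eqP an _] ->.
rewrite /ket big_filter [RHS]big_mkcond; apply: eq_bigr => b _.
by case: eqP => // /eqP bn; rewrite wip_size ?mulr0 // an eq_sym.
Qed.

(** In an orthonormal family spanning all letters of [psi], n! <psi|psi> is a sum of squared moduli,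
    by the Gram form of the permanent. *)
Lemma fip_homog_ge0 n psi : homog n psi -> 0 <= fip ip psi psi.
Proof.
move=> /allP homog_psi.
have [E _ span] := gram_schmidt ipH (flatten [seq a.2 | a <- psi]).
have n_gt0 : 0 < n`!%:R :> R[i] by rewrite ltr0n fact_gt0.
rewrite -(pmulr_rge0 _ n_gt0).
suff -> : n`!%:R * fip ip psi psi =
    \sum_(f : {ffun 'I_n -> 'I_(size E)})
      (\sum_(a <- psi) a.1 * coordinate ip f a.2)^* *
      (\sum_(a <- psi) a.1 * coordinate ip f a.2).
  by apply: sumr_ge0 => f _; rewrite mulrC mul_conjC_ge0.
under [RHS]eq_bigr => f _ do rewrite rmorph_sum mulr_suml.
rewrite exchange_big /= mulr_sumr; apply: eq_big_seq => a a_psi.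
under [RHS]eq_bigr => f _ do rewrite mulr_sumr.
rewrite exchange_big /= mulr_sumr; apply: eq_big_seq => b b_psi.
rewrite mulrCA (@wip_gram _ _ _ ipH E n); first last.
- exact/eqP/homog_psi.
- exact/eqP/homog_psi.
- by move=> v vb; apply: span; apply/flattenP; exists b.2 => //; exact: map_f.
rewrite mulr_sumr; apply: eq_bigr => f _.
by rewrite rmorphM /= mulrACA.
Qed.

Lemma fip_ge0 psi : 0 <= fip ip psi psi.
Proof.
have [N psiN] := degree_bound psi; rewrite (fip_degree_part psiN).
by apply: sumr_ge0 => n _; apply: fip_homog_ge0; exact: homog_degree_part.
Qed.

Lemma fnorm_ge0 psi : 0 <= fnorm ip psi.
Proof. exact: sqrtr_ge0. Qed.

Lemma fnorm_sq psi : (fnorm ip psi ^+ 2)%:C = fip ip psi psi.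
Proof. by rewrite sqr_sqrtr ?ReE ?fip_ge0 // -ler0c ReE fip_ge0. Qed.

(** Formal combinations carry only a semidefinite form, but positivity on all z psi + chi is
    enough. *)
Lemma fip_CS psi chi : cabs (fip ip psi chi) <= fnorm ip psi * fnorm ip chi.
Proof.
rewrite -ler_sqr ?nnegrE ?cabs_ge0 ?mulr_ge0 ?fnorm_ge0 // exprMn.
have sqE xi : fnorm ip xi ^+ 2 = complex.Re (fip ip xi xi).
  by apply: complexI; rewrite fnorm_sq ReE ?fip_ge0.
rewrite !sqE.
apply: sesquilinear_CS; rewrite ?fip_ge0 // => z.
have := fip_ge0 (formal_scale z psi ++ chi); congr (_ <= _).
rewrite fip_catl !fip_catr !fip_scalel !fip_scaler (fipC chi psi).
by ring.
Qed.

Lemma fnorm_sq_degree_part psi N : all (fun a => (size a.2 < N)%N) psi ->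
  \sum_(n < N) fnorm ip (degree_part n psi) ^+ 2 = fnorm ip psi ^+ 2.
Proof.
move=> psiN; apply: complexI; rewrite fnorm_sq (fip_degree_part psiN) rmorph_sum /=.
by apply: eq_bigr => n _; rewrite fnorm_sq.
Qed.

(** The membership criterion used throughout: square-summable bounds on the homogeneous parts
    combine by Cauchy-Schwarz over degrees into the bound sqrt B. *)
Lemma graded_in_Fock Phi (b : nat -> R) (B : R) :
  (forall K, \sum_(n < K) b n ^+ 2 <= B) ->
  (forall n psi, homog n psi -> cabs (fapply Phi psi) <= b n * fnorm ip psi) ->
  in_Fock ip Phi.
Proof.
move=> sum_b bound; exists (Num.sqrt B) => psi.
have [N psiN] := degree_bound psi; rewrite (fapply_degree_part _ psiN).
apply: le_trans (cabs_sum _ _ _) _.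
apply: le_trans (_ : \sum_(n < N) b n * fnorm ip (degree_part n psi) <= _).
  by apply: ler_sum => n _; apply: bound; exact: homog_degree_part.
apply: le_trans (ler_norm _) _; rewrite -sqrtr_sqr.
have -> : Num.sqrt B * fnorm ip psi = Num.sqrt (B * fnorm ip psi ^+ 2).
  rewrite sqrtrM ?sqrtr_sqr ?ger0_norm ?fnorm_ge0 //.
  by apply: le_trans (sum_b 0%N); rewrite big_ord0.
rewrite ler_wsqrtr // -(fnorm_sq_degree_part psiN).
apply: le_trans (sum_CS _ _ (fun n => fnorm ip (degree_part n psi))) _.
by rewrite ler_wpM2r // sumr_ge0 // => n _; exact: sqr_ge0.
Qed.

End FockInnerProduct.

(** * Adjointness, the commutation relation, and the inclusion of domains *)

Section CreatorsAnnihilators.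
Variables (R : realType) (V : lmodType R[i]) (ip : V -> V -> R[i]).
Hypothesis ipH : is_complex_hilbert ip.
Implicit Types (u v : V) (w : seq V) (psi chi : seq (R[i] * seq V)) (Phi : seq V -> R[i]).

Definition creator v psi : seq (R[i] * seq V) := [seq (a.1, v :: a.2) | a <- psi].

Definition annihilator v psi : seq (R[i] * seq V) :=
  [seq (a.1 * b.1, b.2) | a <- psi, b <- ann_word ip v a.2].

Lemma fapply_ann_ext v Phi psi :
  fapply (ann_ext v Phi) psi = fapply Phi (creator v psi).
Proof. by rewrite /fapply big_map. Qed.

Lemma fapply_cre_ext v Phi psi :
  fapply (cre_ext ip v Phi) psi = fapply Phi (annihilator v psi).
Proof.
rewrite /fapply big_allpairs_dep /=; apply: eq_bigr => a _.
rewrite /cre_ext /fapply mulr_sumr; apply: eq_bigr => b _.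
by rewrite rmorphM /= mulrA.
Qed.

Lemma ann_ext_ket v chi : ann_ext v (ket ip chi) =1 ket ip (annihilator v chi).
Proof.
move=> w; rewrite /ket big_allpairs_dep /=; apply: eq_bigr => b _.
rewrite wip_cons mulr_sumr big_map -[size b.2]subn0 big_mkord subn0.
by apply: eq_bigr => j _; rewrite mulrA.
Qed.

Lemma fip_creator v psi chi :
  fip ip (creator v psi) chi = fip ip psi (annihilator v chi).
Proof.
by rewrite !fipE -fapply_ann_ext; apply: eq_fapply => w _; exact: ann_ext_ket.
Qed.

Lemma fip_annihilator v psi chi :
  fip ip (annihilator v psi) chi = fip ip psi (creator v chi).
Proof. by rewrite (fipC ipH) -fip_creator -(fipC ipH). Qed.

Lemma ann_word_cons v u w : ann_word ip v (u :: w) =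
  (ip v u, w) :: [seq (b.1, u :: b.2) | b <- ann_word ip v w].
Proof.
rewrite /ann_word /= drop0; congr cons.
by rewrite -[1%N]/(1 + 0)%N iotaDl -!map_comp.
Qed.

(** The relation a(v) c(u) = <v|u> + c(u) a(v), from the Leibniz rule. It is tested against words
    because the two sides are different lists. *)
Lemma ket_commutation v u chi w :
  ket ip (annihilator v (creator u chi)) w =
  ip v u * ket ip chi w + ket ip (creator u (annihilator v chi)) w.
Proof.
rewrite /ket [RHS]addrC big_map !big_allpairs_dep big_map /= mulr_sumr -big_split /=.
apply: eq_bigr => b _; rewrite ann_word_cons big_cons big_map /= addrC.
by congr (_ + _); rewrite mulrA [b.1 * _]mulrC.
Qed.

Lemma fip_creator_creator v psi :
  fip ip (creator v psi) (creator v psi) =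
  ip v v * fip ip psi psi + fip ip (annihilator v psi) (annihilator v psi).
Proof.
rewrite fip_creator fip_annihilator !fipE /fapply mulr_sumr -big_split /=.
by apply: eq_bigr => a _; rewrite ket_commutation mulrDr mulrCA.
Qed.

Lemma fnorm_creator v psi :
  fnorm ip (creator v psi) ^+ 2 =
  vnorm ip v ^+ 2 * fnorm ip psi ^+ 2 + fnorm ip (annihilator v psi) ^+ 2.
Proof.
apply: complexI; rewrite rmorphD /= !(fnorm_sq ipH) fip_creator_creator.
by rewrite rmorphM /= (fnorm_sq ipH) (vnorm_sq ipH).
Qed.

Lemma homog_creator v n psi : homog n psi -> homog n.+1 (creator v psi).
Proof. by rewrite /homog all_map. Qed.

Lemma homog_annihilator v n psi : homog n.+1 psi -> homog n (annihilator v psi).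
Proof.
move=> /allP homog_psi; apply/allP => _ /allpairsPdep[a [b [a_psi + ->]]] /=.
case/mapP => j; rewrite mem_iota /= add0n => j_lt ->.
by rewrite -/(delete j a.2) size_delete // (eqP (homog_psi a a_psi)).
Qed.

Lemma annihilator_homog0 v psi : homog 0 psi -> annihilator v psi = [::].
Proof.
elim: psi => //= a psi IH /andP[/nilP a0 /IH].
by rewrite /annihilator /= a0 => ->.
Qed.

(** A bound passes to the adjoint: |a psi|^2 = <psi|c a psi> is at most |psi| |c a psi|; square,
    insert the bound and cancel |a psi|^2. *)
Lemma fnorm_annihilator_le v psi (k : R) : 0 <= k ->
  fnorm ip (creator v (annihilator v psi)) ^+ 2 <=
    k * fnorm ip (annihilator v psi) ^+ 2 ->
  fnorm ip (annihilator v psi) ^+ 2 <= k * fnorm ip psi ^+ 2.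
Proof.
set x := fnorm ip (annihilator v psi); set y := fnorm ip (creator _ _) => k0 yx.
have x0 : 0 <= x by exact: fnorm_ge0.
have y0 : 0 <= y by exact: fnorm_ge0.
have p0 : 0 <= fnorm ip psi by exact: fnorm_ge0.
have xy : x ^+ 2 <= fnorm ip psi * y.
  apply: le_trans (fip_CS ipH _ _); rewrite -fip_annihilator -(fnorm_sq ipH).
  by rewrite cabs_real ?sqr_ge0.
have [->|xn0] := eqVneq x 0; first by rewrite expr0n mulr_ge0 ?sqr_ge0.
have x2 : 0 < x ^+ 2 by rewrite exprn_gt0 // lt_def xn0.
rewrite -(ler_pM2r x2) -expr2.
apply: le_trans (_ : (fnorm ip psi * y) ^+ 2 <= _).
  by rewrite ler_sqr ?nnegrE ?mulr_ge0 ?sqr_ge0.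
rewrite exprMn [k * _]mulrC -[leRHS]mulrA.
by apply: ler_wpM2l => //; exact: sqr_ge0.
Qed.

(** In degree n + 1, the induction hypothesis applied to a(v) psi bounds |a(v) psi|^2 with factor n
    + 1 by duality; the commutator term adds one more. *)
Lemma creator_bound v n psi : homog n psi ->
  fnorm ip (creator v psi) ^+ 2 <= n.+1%:R * vnorm ip v ^+ 2 * fnorm ip psi ^+ 2.
Proof.
elim: n psi => [|n IH] psi homog_psi; rewrite fnorm_creator.
  rewrite annihilator_homog0 // mul1r.
  by rewrite /fnorm /fip big_nil sqrtr0 expr0n addr0.
rewrite -[n.+2%:R]natr1 mulrDl mul1r mulrDl addrC lerD2r.
apply: fnorm_annihilator_le; first by rewrite mulr_ge0 ?sqr_ge0.
exact/IH/homog_annihilator.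
Qed.

Lemma annihilator_bound v n psi : homog n.+1 psi ->
  fnorm ip (annihilator v psi) ^+ 2 <= n.+1%:R * vnorm ip v ^+ 2 * fnorm ip psi ^+ 2.
Proof.
move=> homog_psi; apply: fnorm_annihilator_le.
  by rewrite mulr_ge0 ?sqr_ge0.
exact/creator_bound/homog_annihilator.
Qed.

Lemma fapply_comp_norm_le Phi n psi : in_Fock ip Phi -> homog n psi ->
  cabs (fapply Phi psi) <= comp_norm ip Phi n * fnorm ip psi.
Proof.
(* Null combinations are excluded from the supremum; there boundedness forces the value 0. Elsewhere
   [M] bounds the set, so the supremum is an upper bound. *)
move=> [M bound] homog_psi; have [psi0|psi_n0] := eqVneq (fnorm ip psi) 0.
  by have := bound psi; rewrite psi0 !mulr0.
have gt0 chi : fnorm ip chi != 0 -> 0 < fnorm ip chi.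
  by move=> n0; rewrite lt_def n0 fnorm_ge0.
rewrite -ler_pdivrMr ?gt0 //; apply: ub_le_sup; last first.
  by exists psi => //; split => //; exact/eqP.
exists M => _ [chi [_ /eqP chi_n0] <-].
by rewrite ler_pdivrMr ?gt0.
Qed.

Lemma sqrtN_ann_ext v Phi : dom_sqrtN ip Phi -> in_Fock ip (ann_ext v Phi).
Proof.
move=> [PhiF [M sumM]]; pose c n := comp_norm ip Phi n.
(* Degree n of a(v) Phi tests Phi in degree n + 1, which reproduces the series of n |Phi_n|^2. *)
apply: (graded_in_Fock ipH (b := fun n => Num.sqrt n.+1%:R * vnorm ip v * `|c n.+1|)
  (B := vnorm ip v ^+ 2 * M)).
  move=> K; have := sumM K.+1; rewrite big_ord_recl mul0r add0r => le_M.
  apply: le_trans (ler_wpM2l (sqr_ge0 _) le_M); rewrite mulr_sumr.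
  apply: ler_sum => n _; rewrite !exprMn sqr_sqrtr ?ler0n // real_normK ?num_real //.
  by rewrite [X in X * _]mulrC -[leLHS]mulrA.
move=> n psi homog_psi; rewrite fapply_ann_ext.
apply: le_trans (fapply_comp_norm_le PhiF (homog_creator v homog_psi)) _.
apply: le_trans (ler_wpM2r (fnorm_ge0 _ _) (ler_norm _)) _.
rewrite -/(c _) [X in _ <= X * _]mulrC -[leRHS]mulrA ler_wpM2l //.
rewrite -ler_sqr ?nnegrE ?mulr_ge0 ?fnorm_ge0 ?vnorm_ge0 ?sqrtr_ge0 //.
by rewrite !exprMn (sqr_sqrtr (ler0n R n.+1)) creator_bound.
Qed.

Lemma sqrtN_cre_ext v Phi : dom_sqrtN ip Phi -> in_Fock ip (cre_ext ip v Phi).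
Proof.
move=> [PhiF [M sumM]]; pose c n := comp_norm ip Phi n.
pose b n := if n is k.+1 then Num.sqrt k.+1%:R * vnorm ip v * `|c k| else 0.
(* Degree n + 1 of c(v) Phi tests Phi in degree n with weight n + 1. This is at most 2n for n >= 1;
   degree 0 is counted apart. *)
apply: (graded_in_Fock ipH (b := b) (B := vnorm ip v ^+ 2 * (c 0%N ^+ 2 + 2 * M))).
  move=> K; apply: le_trans (_ : \sum_(n < K.+2) b n ^+ 2 <= _).
    by rewrite [leRHS]big_ord_recr [X in _ <= X + _]big_ord_recr /= -addrA lerDl addr_ge0 ?sqr_ge0.
  rewrite big_ord_recl expr0n add0r.
  apply: le_trans (_ : vnorm ip v ^+ 2 * \sum_(n < K.+1) n.+1%:R * c n ^+ 2 <= _).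
    rewrite mulr_sumr; apply: ler_sum => n _ /=.
    rewrite !exprMn sqr_sqrtr ?ler0n // real_normK ?num_real //.
    by rewrite [X in X * _]mulrC -[leLHS]mulrA.
  rewrite ler_wpM2l ?sqr_ge0 //.
  apply: le_trans (_ : c 0%N ^+ 2 + 2 * (\sum_(n < K.+1) n%:R * c n ^+ 2) <= _); last first.
    by rewrite lerD2l ler_wpM2l.
  rewrite !big_ord_recl mul1r mul0r add0r lerD2l mulr_sumr.
  apply: ler_sum => n _; rewrite mulrA ler_wpM2r ?sqr_ge0 // -natrM ler_nat.
  by rewrite !lift0 mul2n -addnn !addSn addnS !ltnS leq_addl.
move=> [|n] psi homog_psi; rewrite fapply_cre_ext.
  by rewrite annihilator_homog0 // fapply_nil cabs0 mul0r.
apply: le_trans (fapply_comp_norm_le PhiF (homog_annihilator v homog_psi)) _.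
apply: le_trans (ler_wpM2r (fnorm_ge0 _ _) (ler_norm _)) _.
rewrite -/(c _) [X in _ <= X * _]mulrC -[leRHS]mulrA ler_wpM2l //.
rewrite -ler_sqr ?nnegrE ?mulr_ge0 ?fnorm_ge0 ?vnorm_ge0 ?sqrtr_ge0 //.
by rewrite !exprMn (sqr_sqrtr (ler0n R n.+1)) annihilator_bound.
Qed.

End CreatorsAnnihilators.

(** * A vector in the common domain but outside D[N^(1/2)] *)

Section DiagonalVector.
Variables (R : realType) (V : lmodType R[i]) (ip : V -> V -> R[i]).
Hypothesis ipH : is_complex_hilbert ip.
Variable e : nat -> V.
Hypothesis oe : forall n, orthonormal ip (mkseq e n).
Implicit Types (v : V) (psi : seq (R[i] * seq V)).

Lemma bessel_sequence v K : \sum_(n < K) cabs (ip v (e n)) ^+ 2 <= vnorm ip v ^+ 2.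
Proof.
have := bessel ipH v (@oe K); rewrite size_mkseq; apply: le_trans.
by apply: ler_sum => n _; rewrite nth_mkseq.
Qed.

Lemma ip_unit n : ip (e n) (e n) = 1.
Proof.
have := @oe n.+1 n n; rewrite size_mkseq eqxx nth_mkseq //.
exact.
Qed.

Definition power n : seq (R[i] * seq V) := [:: (1, nseq n (e n))].

Lemma homog_power n : homog n (power n).
Proof. by rewrite /homog /= size_nseq eqxx. Qed.

Lemma ket_power n w : ket ip (power n) w = wip ip w (nseq n (e n)).
Proof. by rewrite /ket big_seq1 mul1r. Qed.

Lemma fnorm_power n : fnorm ip (power n) ^+ 2 = n`!%:R.
Proof.
apply: complexI; rewrite (fnorm_sq ipH) rmorph_nat fipE /fapply big_seq1 /=.
rewrite rmorph1 mul1r ket_power wip_nseqr ?size_nseq //.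
rewrite big1_seq ?mulr1 // => u /= /nseqP[-> _].
exact: ip_unit.
Qed.

Lemma prod_ip_nseq n m : \prod_(u <- nseq m (e n)) ip u (e n) = 1.
Proof. by rewrite big1_seq // => u /= /nseqP[-> _]; exact: ip_unit. Qed.

(** In SV, a(v) e_n^n = n <v|e_n> e_n^(n-1). By adjointness the norm is a sum of n equal terms n!
    |<v|e_n>|^2. *)
Lemma fnorm_annihilator_power v n :
  fnorm ip (annihilator ip v (power n)) ^+ 2 = n%:R * n`!%:R * cabs (ip v (e n)) ^+ 2.
Proof.
apply: complexI; rewrite (fnorm_sq ipH) -fip_creator fipE.
rewrite /fapply big_map big_allpairs_dep big_seq1 /= big_map size_nseq.
rewrite -[X in iota 0 X]subn0 big_mkord.
transitivity (\sum_(j < n) (n`!%:R * (ip v (e n) * (ip v (e n))^*) : R[i])).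
  apply: eq_bigr => j _; rewrite mul1r nth_nseq ltn_ord ket_power.
  rewrite -/(delete j _) delete_nseq // wip_nseqr /=; last first.
    by rewrite size_nseq prednK // (leq_ltn_trans _ (ltn_ord j)).
  by rewrite big_cons prod_ip_nseq mulr1 mulrCA [_ * ip v _]mulrC.
rewrite sumr_const card_ord -[LHS]mulr_natl -natrM rmorphM /= cabs_sq rmorph_nat.
by rewrite natrM mulrA.
Qed.

Lemma fnorm_creator_power v n :
  fnorm ip (creator v (power n)) ^+ 2 =
  n`!%:R * (vnorm ip v ^+ 2 + n%:R * cabs (ip v (e n)) ^+ 2).
Proof.
by rewrite fnorm_creator // fnorm_power fnorm_annihilator_power; ring.
Qed.

(** As e_n^n has norm sqrt(n!), this coefficient gives the component of degree n the norm 1/n. *)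
Definition diagonal_weight n : R := n%:R^-1 / Num.sqrt n`!%:R.

(* The formal series sum_n e_n^n / (n sqrt n!); the n = 0 term vanishes since 0^-1 = 0. *)
Definition diagonal_vector (w : seq V) : R[i] :=
  (diagonal_weight (size w))%:C * ket ip (power (size w)) w.

Lemma diagonal_weight_ge0 n : 0 <= diagonal_weight n.
Proof. by rewrite mulr_ge0 ?invr_ge0 ?sqrtr_ge0. Qed.

Lemma diagonal_weight_sq n : diagonal_weight n ^+ 2 * n`!%:R = n%:R^-1 ^+ 2.
Proof.
rewrite exprMn [X in _ * X * _]exprVn sqr_sqrtr // mulfVK //.
by rewrite pnatr_eq0 -lt0n fact_gt0.
Qed.

Lemma fapply_diagonal_vector n psi : homog n psi ->
  fapply diagonal_vector psi = (diagonal_weight n)%:C * fip ip psi (power n).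
Proof.
move=> /allP homog_psi; rewrite fipE /fapply mulr_sumr.
apply: eq_big_seq => a /homog_psi /eqP size_a.
by rewrite /diagonal_vector size_a mulrCA.
Qed.

Lemma diagonal_CS psi chi n :
  cabs ((diagonal_weight n)%:C * fip ip psi chi) <=
  diagonal_weight n * fnorm ip chi * fnorm ip psi.
Proof.
rewrite cabsM cabs_real ?diagonal_weight_ge0 // -mulrA ler_wpM2l ?diagonal_weight_ge0 //.
by rewrite mulrC fip_CS.
Qed.

Lemma diagonal_in_Fock : in_Fock ip diagonal_vector.
Proof.
apply: (graded_in_Fock ipH (B := 2)
  (b := fun n => diagonal_weight n * fnorm ip (power n))) => [K|n psi homog_psi].
  apply: le_trans _ (sum_inv_sq_le R K); apply: ler_sum => n _.
  by rewrite exprMn fnorm_power diagonal_weight_sq.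
by rewrite (fapply_diagonal_vector homog_psi); exact: diagonal_CS.
Qed.

Lemma diagonal_ann_in_Fock v : in_Fock ip (ann_ext v diagonal_vector).
Proof.
apply: (graded_in_Fock ipH (B := vnorm ip v ^+ 2)
  (b := fun n => diagonal_weight n.+1 * fnorm ip (annihilator ip v (power n.+1))))
  => [K|n psi homog_psi].
  (* The squared bound in degree n is |<v|e_(n+1)>|^2 / (n+1). Bessel is taken over K + 1 terms
     because of the shift. *)
  apply: le_trans _ (bessel_sequence v K.+1).
  rewrite big_ord_recl; apply: le_trans (_ : \sum_(n < K) cabs (ip v (e n.+1)) ^+ 2 <= _).
    apply: ler_sum => n _; rewrite exprMn fnorm_annihilator_power.
    set c := cabs _; set w := diagonal_weight _.
    have -> : w ^+ 2 * (n.+1%:R * n.+1`!%:R * c ^+ 2) =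
        w ^+ 2 * n.+1`!%:R * n.+1%:R * c ^+ 2 by ring.
    rewrite diagonal_weight_sq.
    by rewrite ler_piMl ?sqr_ge0 // expr2 mulfVK ?pnatr_eq0 // invf_le1 ?ler1n ?ltr0n.
  by rewrite lerDr sqr_ge0.
rewrite fapply_ann_ext (fapply_diagonal_vector (homog_creator v homog_psi)).
by rewrite fip_creator; exact: diagonal_CS.
Qed.

Lemma diagonal_cre_in_Fock v : in_Fock ip (cre_ext ip v diagonal_vector).
Proof.
pose b n := if n is k.+1 then diagonal_weight k * fnorm ip (creator v (power k)) else 0.
apply: (graded_in_Fock ipH (B := vnorm ip v ^+ 2 * 2 + vnorm ip v ^+ 2) (b := b)).
  move=> K; apply: le_trans (_ : \sum_(n < K.+1) b n ^+ 2 <= _).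
    by rewrite [leRHS]big_ord_recr /= lerDl sqr_ge0.
  rewrite big_ord_recl expr0n add0r.
  (* For n >= 1, e_n^n contributes |v|^2 / n^2 + |<v|e_n>|^2 / n: the first part is summable, the
     second is controlled by Bessel. *)
  apply: le_trans _ (lerD (ler_wpM2l (sqr_ge0 _) (sum_inv_sq_le R K)) (bessel_sequence v K)).
  rewrite mulr_sumr -big_split /=; apply: ler_sum => n _.
  rewrite exprMn fnorm_creator_power mulrA diagonal_weight_sq mulrDr.
  rewrite [_ * vnorm ip v ^+ 2]mulrC lerD2l mulrA ler_piMl ?sqr_ge0 //.
  case: (val n) => [|k]; first by rewrite mulr0.
  by rewrite expr2 mulfVK ?pnatr_eq0 // invf_le1 ?ler1n ?ltr0n.
move=> [|n] psi homog_psi; rewrite fapply_cre_ext.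
  by rewrite annihilator_homog0 // fapply_nil cabs0 mul0r.
rewrite (fapply_diagonal_vector (homog_annihilator ip v homog_psi)) fip_annihilator //.
exact: diagonal_CS.
Qed.

(** Test the functional on e_n^n itself; this lower bound already gives divergence. *)
Lemma diagonal_comp_norm_ge n : n%:R^-1 <= comp_norm ip diagonal_vector n.
Proof.
have := fapply_comp_norm_le diagonal_in_Fock (homog_power n).
rewrite (fapply_diagonal_vector (homog_power n)) -(fnorm_sq ipH) cabsM.
rewrite !cabs_real ?sqr_ge0 ?diagonal_weight_ge0 // expr2 mulrA.
have fact_gt0R : 0 < n`!%:R :> R by rewrite ltr0n fact_gt0.
have -> : fnorm ip (power n) = Num.sqrt n`!%:R.
  by rewrite -fnorm_power sqrtr_sqr ger0_norm ?fnorm_ge0.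
rewrite ler_pM2r ?sqrtr_gt0 // mulfVK //.
by rewrite gt_eqF ?sqrtr_gt0.
Qed.

Lemma diagonal_not_sqrtN : ~ dom_sqrtN ip diagonal_vector.
Proof.
(* By the Archimedean property k/2 exceeds [M], while 2^k terms of the harmonic series reach k/2. *)
move=> [_ [M sumM]]; pose k := Num.bound `|2 * M|.
suff : k%:R / 2 <= M.
  rewrite ler_pdivrMr // mulrC leNgt => /negP; apply.
  by apply: le_lt_trans (ler_norm _) _; exact: archi_boundP.
apply: le_trans (harmonic_dyadic_ge R k) (le_trans _ (sumM (2 ^ k).+1)).
rewrite [leRHS]big_ord_recl mul0r add0r; apply: ler_sum => n _.
have inv0 : 0 <= n.+1%:R^-1 :> R by rewrite invr_ge0.
apply: le_trans (_ : n.+1%:R * n.+1%:R^-1 ^+ 2 <= _).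
  by rewrite expr2 mulVKf // pnatr_eq0.
rewrite lift0 ler_wpM2l // ler_sqr ?nnegrE ?diagonal_comp_norm_ge //.
exact: le_trans inv0 (diagonal_comp_norm_ge _).
Qed.

End DiagonalVector.

Theorem theorem3 (R : realType) (V : lmodType R[i]) (ip : V -> V -> R[i]) :
  is_complex_hilbert ip -> infinite_dimensional V ->
  [set Phi : seq V -> R[i] | dom_sqrtN ip Phi] `<` [set Phi | common_dom ip Phi].
Proof.
move=> ipH infV; split.
  move=> Phi /= PhiN v; have PhiF := PhiN.1.
  by split; split=> //; [exact: sqrtN_cre_ext | exact: sqrtN_ann_ext].
have [e oe] := orthonormal_sequence ipH infV.
(* The reverse inclusion would put the diagonal vector in D[N^(1/2)]. *)
move=> /(_ (diagonal_vector ip e)) sub; apply: (diagonal_not_sqrtN ipH oe).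
apply: sub => v /=; have diagF := diagonal_in_Fock ipH oe.
by split; split=> //; [exact: diagonal_cre_in_Fock | exact: diagonal_ann_in_Fock].
Qed.
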